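(* Let $n\ge 1$. The set $\mathcal{B}_n=\{\mathbf{P}_{\pi}(\mathbf{x};t) : \pi\vdash[n]\}$, where $\pi$ ranges over all set partitions of $[n]$, is a $\mathbb{Q}[t]$-basis of the symmetric functions of homogeneous degree $n$ in noncommuting variables $\mathbf{x}=(\mathbf{x}_1,\mathbf{x}_2,\ldots)$ (with coefficients in $\mathbb{Q}[t]$), and it is invariant under any permutation of $[n]$; that is, $w\mathcal{B}_n=\mathcal{B}_n$ for any $w\in\mathfrak{S}_n$, where $w\mathcal{B}_n=\{w\circ \mathbf{P}_\pi(\mathbf{x};t):\pi\vdash[n]\}$.
   Context: Set partitions. A set partition $\pi=\pi_1/\cdots/\pi_l\vdash[n]$ is a set of disjoint nonempty blocks with union $[n]$; $\lambda(\pi)$ is the partition of $n$ listing the block sizes in weakly decreasing order. A permutation $\delta\in\mathfrak{S}_n$ acts by $\delta\pi=\delta(\pi_1)/\cdots/\delta(\pi_l)$. For a partition $\mu=(\mu_1,\ldots,\mu_l)\vdash n$, $[\mu]$ is the set partition of $[n]$ whose blocks are the consecutive intervals $\{1,\ldots,\mu_1\},\{\mu_1+1,\ldots,\mu_1+\mu_2\},\ldots$. The permutation $\delta_\pi\in\mathfrak{S}_n$ is given in one-line notation by listing the blocks of $\pi$ in weakly decreasing size, blocks of equal size in increasing order of smallest element, the elements of each block in increasing order, and erasing the bars; thus $\pi=\delta_\pi[\lambda(\pi)]$. For a partition $\mu=\langle 1^{m_1}2^{m_2}\cdots\rangle$ put $\mu^!=m_1!m_2!\cdots$. The order $\le$ on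 partitions of $n$ is dominance order. Noncommuting variables. A permutation $\delta\in\mathfrak{S}_n$ acts on degree-$n$ monomials by $\delta\circ(\mathbf{x}_{i_1}\cdots\mathbf{x}_{i_n})=\mathbf{x}_{i_{\delta^{-1}(1)}}\cdots\mathbf{x}_{i_{\delta^{-1}(n)}}$, extended linearly. For $\pi\vdash[n]$, $\mathbf{m}_\pi=\sum \mathbf{x}_{i_1}\cdots\mathbf{x}_{i_n}$ over all tuples $(i_1,\ldots,i_n)$ of positive integers with $i_a=i_b$ if and only if $a,b$ lie in the same block of $\pi$. The symmetric functions of homogeneous degree $n$ in noncommuting variables, $\mathrm{NCSym}^n$, are the span of $\{\mathbf{m}_\pi:\pi\vdash[n]\}$ (coefficients extended from $\mathbb{Q}$ to $\mathbb{Q}[t]$). Hall-Littlewood (HL) functions. $P_\lambda(t)=P_\lambda(X;t)$ denotes the classical Hall-Littlewood symmetric function in commuting variables $X=(x_1,x_2,\ldots)$, and $c_{\lambda\mu}(t)\in\mathbb{Z}[t]$ are defined by $P_\lambda(t)=\sum_{\mu\le\lambda}c_{\lambda\mu}(t)m_\mu$ (so $c_{\lambda\lambda}(t)=1$). For $\pi\vdash[n]$ with $\lambda(\pi)=\lambda$, the HL function in noncommuting variables is $$\mathbf{P}_\pi(t)=\mathbf{P}_\pi(\mathbf{x};t)=\sum_{\mu\le\lambda}\frac{c_{\lambda\mu}(t)}{\mu^!}\sum_{g\in G_\pi}g\circ\mathbf{m}_{\delta_\pi[\mu]},\qquad G_\pi=\{\delta\in\mathfrak{S}_n:\delta\pi=\pi\}.$$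 *)

(* Defs.v *)
From HB Require Import structures.
From mathcomp Require Import all_boot all_order all_algebra all_fingroup.
From mathcomp Require Import fraction.
From mathcomp Require Import mpoly.

Set Implicit Arguments.
Unset Strict Implicit.
Unset Printing Implicit Defensive.

Import GRing.Theory.

Local Open Scope nat_scope.

(** * Integer partitions, as weakly decreasing sequences of positive integers *)

Definition intpart (n : nat) (s : seq nat) : bool :=
  [&& sorted geq s, 0 \notin s & sumn s == n].

Definition intparts (n : nat) : seq (seq nat) :=
  [seq s <- codom (fun b : {bseq n of 'I_n.+1} => map val b) | intpart n s].

Lemma mem_intparts n s : (s \in intparts n) = intpart n s.
Proof.
rewrite mem_filter; case: (boolP (intpart n s)) => //= /and3P[_ s0 /eqP ns].
have sz (r : seq nat) : 0 \notin r -> size r <= sumn r.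
  elim: r => //= x r IH; rewrite inE negb_or eq_sym -lt0n => /andP[x0 /IH].
  by move=> le_r; rewrite -add1n leq_add.
have lt_n x : x \in s -> x < n.+1.
  by rewrite ltnS -ns sumnE => xs; rewrite (big_rem x xs) leq_addr.
have sn : size (map (@inord n) s) <= n by rewrite size_map -ns sz.
apply/codomP; exists (Bseq sn) => /=.
by rewrite -map_comp -[LHS]map_id; apply/eq_in_map => x xs /=; rewrite inordK ?lt_n.
Qed.

Lemma intparts_uniq n : uniq (intparts n).
Proof.
apply: filter_uniq; rewrite map_inj_uniq ?enum_uniq // => b c eq_bc.
by apply/val_inj/(inj_map val_inj).
Qed.

(* Dominance order; beyond [size mu] the partial sums of [mu] are constant. *)
Definition dominated (mu la : seq nat) : bool :=
  [forall k : 'I_(size mu).+1, sumn (take k mu) <= sumn (take k la)].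

Lemma dominatedP mu la :
  reflect (forall k, sumn (take k mu) <= sumn (take k la)) (dominated mu la).
Proof.
apply: (iffP forallP) => [H k|H k]; last exact: H.
have [lek|ltk] := leqP k (size mu); first exact: (H (Ordinal (lek : k < _.+1))).
have := H ord_max; rewrite /= take_size (take_oversize (ltnW ltk)).
move/leq_trans; apply; rewrite -[in X in _ <= X](subnKC (ltnW ltk)) takeD.
by rewrite sumn_cat leq_addr.
Qed.

(* [m_1! m_2! ...], where [m_i] is the multiplicity of the part [i]. *)
Definition mult_fact (mu : seq nat) : nat :=
  \prod_(i <- undup mu) (count_mem i mu)`!.

(** * Set partitions of [n], the ground set being ['I_n] = {0, ..., n-1} *)

Record setpart (n : nat) := SetPart {
  blocks :> {set {set 'I_n}};
  blocksP : partition blocks [set: 'I_n]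
}.
HB.instance Definition _ n := [isSub for @blocks n].
HB.instance Definition _ n := [Finite of setpart n by <:].

Section SetPartitions.
Variable n : nat.
Implicit Types (P : {set {set 'I_n}}) (A B : {set 'I_n}) (pi : setpart n).

Definition pact (d : 'S_n) P : {set {set 'I_n}} :=
  [set [set d i | i in A] | A : {set 'I_n} in P].

Definition block_type pi : seq nat :=
  sort geq [seq #|A| | A : {set 'I_n} <- enum pi].

Definition intervals (mu : seq nat) : {set {set 'I_n}} :=
  [set [set i : 'I_n | sumn (take k mu) <= i < sumn (take k.+1 mu)]
     | k : 'I_(size mu)].

(* [enum A] lists [A] in increasing order, so its head is the minimum of [A]. *)
Definition min_elt A : nat := head 0 [seq val i | i <- enum A].

Definition block_le A B : bool :=
  (#|B| < #|A|) || ((#|A| == #|B|) && (min_elt A <= min_elt B)).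

Definition delta_word pi : seq 'I_n :=
  flatten [seq enum A | A : {set 'I_n} <- sort block_le (enum pi)].

Lemma delta_word_perm pi : perm_eq (delta_word pi) (enum 'I_n).
Proof.
have /and3P[/eqP covP trP _] := blocksP pi.
have perm_w : perm_eq (delta_word pi)
    (flatten [seq enum A | A : {set 'I_n} <- enum pi]).
  by apply: perm_flatten; apply: perm_map; rewrite perm_sort.
apply/(perm_trans perm_w)/allP => i _ /=; apply/eqP.
rewrite (count_uniq_mem _ (enum_uniq _)) mem_enum count_flatten -map_comp.
rewrite sumnE big_map big_enum /=.
have : i \in cover pi by rewrite covP inE.
case/bigcupP => A piA iA; rewrite (bigD1 A) //=.
rewrite (count_uniq_mem _ (enum_uniq _)) mem_enum iA big1 // => B /andP[piB nBA].
rewrite (count_uniq_mem _ (enum_uniq _)) mem_enum; case: (boolP (i \in B)) => // iB.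
by have /trivIsetP/(_ B A piB piA nBA)/disjointFr/(_ iB) := trP; rewrite iA.
Qed.

Definition delta_fun pi (i : 'I_n) : 'I_n := nth i (delta_word pi) i.

Lemma delta_fun_inj pi : injective (delta_fun pi).
Proof.
have pw := delta_word_perm pi.
have szw : size (delta_word pi) = n by rewrite (perm_size pw) size_enum_ord.
have uw : uniq (delta_word pi) by rewrite (perm_uniq pw) enum_uniq.
move=> i j; rewrite /delta_fun (set_nth_default i j) ?szw // => /eqP.
by rewrite nth_uniq ?szw // => /eqP/val_inj.
Qed.

(* The permutation whose one-line notation is [delta_word pi]. *)
Definition delta pi : 'S_n := perm (@delta_fun_inj pi).

Definition stab pi : {set 'S_n} := [set d : 'S_n | pact d pi == pi].

End SetPartitions.

Local Open Scope ring_scope.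

(* Only imported here: several names of [classical_sets] clash with [finset]. *)
From mathcomp Require Import boolp classical_sets functions.

(** * Classical Hall-Littlewood polynomials *)

Section HallLittlewood.
Variable N : nat.

Local Notation "p %:F" := (FracField.tofrac p).
Local Notation K := {fraction {mpoly {poly int}[N]}}.

Definition HL_x (i : 'I_N) : K := ('X_i : {mpoly {poly int}[N]})%:F.
Definition HL_t : K := (('X : {poly int})%:MP_[N])%:F.
Local Notation x := HL_x.
Local Notation t := HL_t.

Definition HL_v (m : nat) : K := \prod_(1 <= i < m.+1) ((1 - t ^+ i) / (1 - t)).

(* [prod_(i >= 0) v_(m_i)], with [la] padded by zeros to length [N], so that
   [m_0] is [N - size la]. *)
Definition HL_vpart (la : seq nat) : K :=
  let s := [seq nth 0%N la i | i <- iota 0 N] in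
  \prod_(a <- undup s) HL_v (count_mem a s).

(* P_la(x_1, ..., x_N; t) =
     v_la(t)^-1 sum_w w (x^la prod_(i < j) (x_i - t x_j) / (x_i - x_j)),
   as an element of the fraction field of Z[t][x_1, ..., x_N]. *)
Definition HL_frac (la : seq nat) : K :=
  (HL_vpart la)^-1 *
  \sum_(w : 'S_N)
     (\prod_(i < N) x (w i) ^+ nth 0%N la i) *
     \prod_(i < N) \prod_(j < N | (i < j)%N)
        ((x (w i) - t * x (w j)) / (x (w i) - x (w j))).

(* [HL_frac la] is in fact a polynomial over Z[t]; this is that polynomial. *)
Definition HL_poly (la : seq nat) : {mpoly {poly int}[N]} :=
  xget 0 [set p | p%:F = HL_frac la]%classic.

Lemma HL_poly_unique (la : seq nat) (p : {mpoly {poly int}[N]}) :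
  p%:F = HL_frac la -> HL_poly la = p.
Proof.
move=> pE; apply: xget_unique => // q qE.
by apply/eqP; rewrite -tofrac_eq qE pE.
Qed.

(* The coefficient of [m_mu] in the expansion of the symmetric polynomial
   [HL_poly la] is its coefficient of [x^mu]. *)
Definition HL_coef (la mu : seq nat) : {poly int} :=
  (HL_poly la)@_[multinom nth 0%N mu i | i < N].

End HallLittlewood.

(** * Symmetric functions in noncommuting variables *)

(* The word [i] stands for the monomial x_(i 0) x_(i 1) ... x_(i (n-1)); the
   variables are indexed by [nat] instead of the positive integers. *)
Definition word (n : nat) : Type := {ffun 'I_n -> nat}.

(* Homogeneous formal series of degree [n] over Q[t], given by their
   coefficients. *)
Notation ncseries n := (word n -> {poly rat}^o).

Section NoncommutingVariables.
Variable n : nat.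

Definition word_act (d : 'S_n) (i : word n) : word n :=
  [ffun k => i ((d^-1)%g k)].

(* Linear extension of [word_act]: the coefficient of [word_act d i] in
   [nc_act d f] is the coefficient of [i] in [f]. *)
Definition nc_act (d : 'S_n) (f : ncseries n) : ncseries n :=
  fun j => f (word_act (d^-1)%g j).

Definition nc_m (P : {set {set 'I_n}}) : ncseries n :=
  fun i => ([forall a, forall b,
     (i a == i b) == [exists A in P, (a \in A) && (b \in A)]])%:R.

(* All partitions of [n] have at most [n] parts, so the coefficients
   c_(la mu)(t) can be read off in [n] commuting variables. *)
Definition nc_HL (pi : setpart n) : ncseries n :=
  let la := block_type pi in
  \sum_(mu <- intparts n | dominated mu la)
    ((mult_fact mu)%:R^-1 *: map_poly (intr : int -> rat) (HL_coef n la mu)) *: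
    \sum_(g in stab pi) nc_act g (nc_m (pact (delta pi) (intervals n mu))).

End NoncommutingVariables.

Section Bases.
Variables (R : nzRingType) (M : lmodType R) (I : finType).

Definition lin_span (b : I -> M) : set M :=
  [set f | exists a : I -> R, f = \sum_i a i *: b i].

Definition is_basis (V : set M) (b : I -> M) : Prop :=
  (forall a : I -> R, \sum_i a i *: b i = 0 -> forall i, a i = 0) /\
  lin_span b = V.

End Bases.

Definition NCSym (n : nat) : set (ncseries n) :=
  lin_span (fun pi : setpart n => nc_m pi).
Arguments NCSym : clear implicits.

(* Main.v *)
Require Import Defs.
From mathcomp Require Import all_boot all_order all_algebra all_fingroup.
From mathcomp Require Import fraction mpoly zify.

(* Expanding over the orbits of the stabilizer of pi, P_pi is a nonzero rational
   multiple of c_{la la}(t) m_pi plus a combination of m_sigma whose types are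
   strictly dominated by la, so the family is a basis of NCSym^n as soon as
   c_{la la}(t) = 1; and w P_pi = P_{w pi} because w delta_pi and delta_{w pi}
   differ by an element of the stabilizer of the consecutive intervals [la].

   For c_{la la}, write the classical P_la as S / (v_la(t) D), where D is the
   Vandermonde product and
     S = sum_w sgn(w) w (x^la prod_{i<j} (x_i - t x_j)).
   With W the stabilizer of la and W(t) = sum_{u in W} t^(inv u), antisymmetry
   forces the inner alternating sums over W to be multiples of the Vandermonde
   products of the level sets of la, whence #|W| S is divisible by W(t).  Since
   W(t) = v_la(t) is monic, S = W(t) Q with Q antisymmetric, so D divides Q and
   P_la = Q / D is a polynomial.  Every w (prod_{i<j} (x_i - t x_j)) has its
   leading monomial at rho, so the coefficient of S at la + rho is exactly W(t)
   and the leading coefficient of P_la is 1. *)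

Set Implicit Arguments.
Unset Strict Implicit.
Unset Printing Implicit Defensive.

Import Order.TTheory GRing.Theory.

Local Open Scope ring_scope.

(** * Divisibility of antisymmetric polynomials *)

Section SkewDivisibility.
Variables (n : nat) (R : idomainType).
Implicit Types (f : {mpoly R[n]}) (p : 'I_n * 'I_n).

(** The substitution X_j := X_i. Its kernel is the ideal of X_i - X_j, so divisibility becomes a
    vanishing condition. *)
Definition mpoly_merge (i j : 'I_n) f : {mpoly R[n]} :=
  f \mPo [tuple 'X_(if k == j then i else k) | k < n].

Lemma mpoly_mergeX i j k :
  mpoly_merge i j 'X_k = 'X_(if k == j then i else k).
Proof. by rewrite /mpoly_merge comp_mpolyXU -tnth_nth tnth_mktuple. Qed.

Lemma mpoly_merge_sub i j f : exists q, f - mpoly_merge i j f = ('X_i - 'X_j) * q.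
Proof.
pose Q g := exists q, g - mpoly_merge i j g = ('X_i - 'X_j) * q.
have QM g h : Q g -> Q h -> Q (g * h).
  (* From gh - g'h' = (g - g')h + g'(h - h'), where the prime denotes merging. Closure under
     products and linear combinations then leaves only the variables to check. *)
  move=> [a Ea] [b Eb]; exists (a * h + mpoly_merge i j g * b).
  rewrite mulrDr mulrA -Ea mulrCA -Eb /mpoly_merge rmorphM /=.
  by rewrite mulrBl mulrBr addrA subrK.
have Q1 : Q 1 by exists 0; rewrite /mpoly_merge rmorph1 subrr mulr0.
elim/mpolyind: f => [|c m g _ _ [q Eq]].
  by exists 0; rewrite /mpoly_merge rmorph0 subrr mulr0.
suff [r Er] : Q 'X_[m].
  exists (c *: r + q); rewrite /mpoly_merge linearP /= opprD addrACA.
  by rewrite -scalerBr mulrDr -Eq -scalerAr -Er.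
rewrite mpolyXE_id; elim/big_rec: _ => // k g' _; apply: (QM).
elim: (m k) => [|d IHd]; first by rewrite expr0.
rewrite exprS; apply: (QM) => //; rewrite /Q mpoly_mergeX.
case: eqP => [->|_]; first by exists (-1); rewrite mulrN1 opprB.
by exists 0; rewrite subrr mulr0.
Qed.

Lemma mpolyXU_inj : injective (fun i : 'I_n => 'X_i : {mpoly R[n]}).
Proof.
move=> i j /= /mpolyP/(_ U_(i)%MM); rewrite !mcoeffX eqxx.
case: eqP => [/mnmP/(_ i)|_ /eqP]; last by rewrite oner_eq0.
by rewrite !mnm1E eqxx; case: eqP.
Qed.

(** Induction on [s]: merging i and j kills none of the factors X_a - X_b already extracted, so in a
    domain it kills the cofactor, which is therefore divisible by X_i - X_j. *)
Lemma prod_mpolyX_sub_dvd (s : seq ('I_n * 'I_n)) f :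
  uniq s -> {in s, forall p, (p.1 < p.2)%N} ->
  {in s, forall p, mpoly_merge p.1 p.2 f = 0} ->
  exists q, f = \prod_(p <- s) ('X_p.1 - 'X_p.2) * q.
Proof.
elim: s => [|[i j] s IHs] /=; first by exists f; rewrite big_nil mul1r.
case/andP=> ijs us lt_s f0.
have [||q Eq] := IHs us; [by move=> p ps; apply: lt_s; rewrite inE ps orbT | |].
  by move=> p ps; apply: f0; rewrite inE ps orbT.
have lt_ij : (i < j)%N by apply: (lt_s (i, j)); rewrite inE eqxx.
have := f0 (i, j); rewrite inE eqxx => /(_ isT) /=.
rewrite {1}Eq {1}/mpoly_merge rmorphM /= rmorph_prod /= => /eqP.
rewrite mulf_eq0 => /orP[|].
  rewrite prodf_seq_eq0 => /hasP[[a b] /= abs].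
  rewrite rmorphB /= -!/(mpoly_merge _ _ _) !mpoly_mergeX subr_eq0.
  move=> /eqP/mpolyXU_inj; have /= := lt_s (a, b); rewrite inE abs orbT => /(_ isT).
  (* If X_a and X_b became equal after merging, then (a, b) = (i, j), which is not in [s], or the
     order a < b would fail. *)
  case: (eqVneq a j) => [->|naj]; case: (eqVneq b j) => [Eb|nbj]; rewrite ?Eb.
  - by rewrite ltnn.
  - by move=> lt_jb Eib; move: (ltn_trans lt_ij lt_jb); rewrite Eib ltnn.
  - by move=> _ Eai; move: ijs; rewrite -Eai -Eb abs.
  - by move=> + Eab; rewrite Eab ltnn.
rewrite -/(mpoly_merge _ _ _) => /eqP q0; have [r Er] := mpoly_merge_sub i j q.
exists r; rewrite Eq big_cons /= -mulrA mulrCA.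
by move: Er; rewrite q0 subr0 => <-.
Qed.

(** Merging does not see the swap of i and j, so the merged polynomial equals its own opposite. *)
Lemma mpoly_merge_skew i j f : 2%:R != 0 :> R ->
  msym (tperm i j) f = - f -> mpoly_merge i j f = 0.
Proof.
move=> two0 /(congr1 (mpoly_merge i j)).
have -> : mpoly_merge i j (msym (tperm i j) f) = mpoly_merge i j f.
  rewrite /mpoly_merge msym_mPo; congr (_ \mPo _); apply: eq_from_tnth => k.
  rewrite !tnth_mktuple; case: tpermP => [->|->|//].
    by rewrite eqxx; case: eqP.
  by rewrite eqxx; case: eqP.
rewrite {2}/mpoly_merge raddfN /= -/(mpoly_merge _ _ _) => /eqP.
rewrite -subr_eq0 opprK -mulr2n -mulr_natl mulf_eq0 => /orP[|/eqP //].
by rewrite -mpolyC_nat mpolyC_eq0 (negPf two0).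
Qed.

(** The predicate [e] allows both uses: pairs inside a level set for the inner sums, and all pairs
    for the full Vandermonde product. *)
Lemma skew_dvd (e : pred ('I_n * 'I_n)) f : 2%:R != 0 :> R ->
  (forall p, (p.1 < p.2)%N -> e p -> msym (tperm p.1 p.2) f = - f) ->
  exists q, f = \prod_(p : 'I_n * 'I_n | (p.1 < p.2)%N && e p) ('X_p.1 - 'X_p.2) * q.
Proof.
move=> two0 skew_f.
have [||| q ->] := @prod_mpolyX_sub_dvd (enum [pred p : 'I_n * 'I_n | (p.1 < p.2)%N && e p]) f.
- exact: enum_uniq.
- by move=> p; rewrite mem_enum inE => /andP[].
- by move=> p; rewrite mem_enum inE => /andP[? ?]; apply: mpoly_merge_skew; auto.
by exists q; rewrite big_enum.
Qed.

End SkewDivisibility.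

(** * Inversions of permutations *)

Section Pairs.
Variable n : nat.
Implicit Types (u v : 'S_n) (p : 'I_n * 'I_n).

Definition lt_pair : pred ('I_n * 'I_n) := fun p => (p.1 < p.2)%N.

(** The image under [u] of an unordered pair, written again in increasing order. *)
Definition upair u p := if (u p.1 < u p.2)%N then (u p.1, u p.2) else (u p.2, u p.1).

Definition upair_invariant u (e : pred ('I_n * 'I_n)) :=
  forall i j, (e (u i, u j) = e (i, j)) * (e (j, i) = e (i, j)).

Lemma upair_lt u p : p.1 != p.2 -> lt_pair (upair u p).
Proof.
rewrite /lt_pair /upair => ne; case: (ltnP (u p.1) (u p.2)) => //=; rewrite leq_eqVlt => /orP[|//].
by move=> /eqP/ord_inj/perm_inj E; rewrite E eqxx in ne.
Qed.

Lemma upairK u p : lt_pair p -> upair u^-1 (upair u p) = p.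
Proof.
case: p => i j; rewrite /lt_pair /upair /= => ltij.
by case: (ltnP (u i) (u j)) => _ /=; rewrite !permK ?ltij // ltnNge ltnW.
Qed.

Lemma reindex_upair (T : Type) (idx : T) (op : Monoid.com_law idx) u
    (e : pred ('I_n * 'I_n)) (F : 'I_n * 'I_n -> T) :
  upair_invariant u e ->
  \big[op/idx]_(p | lt_pair p && e p) F p =
  \big[op/idx]_(p | lt_pair p && e p) F (upair u p).
Proof.
move=> inv_e; rewrite (reindex_onto (upair u) (upair u^-1)) /=; last first.
  by move=> p /andP[lt_p _]; rewrite -{1}[u]invgK upairK.
apply: eq_bigl => p; case: (boolP (lt_pair p)) => lt_p /=.
  rewrite upairK // eqxx andbT upair_lt /=; last first.
    by case: eqP => // E; rewrite /lt_pair E ltnn in lt_p.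
  by case: p {lt_p} => i j; rewrite /upair; case: ifP => _ /=; rewrite (inv_e _ _).1 ?(inv_e i j).2.
apply/andP => -[/andP[lt_up _] /eqP E]; move: lt_p.
rewrite -E upair_lt //; apply/negP => /eqP E'.
by rewrite /lt_pair E' ltnn in lt_up.
Qed.

Definition inversions u : nat := \sum_(p | lt_pair p) (u p.2 < u p.1).

(** Permuting the columns of the Vandermonde matrix at 0, ..., n-1 multiplies its determinant by the
    sign of [u], while the product formula changes by one sign per inversion. *)
Lemma odd_inversions (R : pzRingType) u : (-1) ^+ inversions u = (-1) ^+ u :> R.
Proof.
suff E : (-1) ^+ inversions u = (-1) ^+ u :> int.
  by have := congr1 (intr : int -> R) E; rewrite !rmorphXn /= rmorphN rmorph1.
pose V := Vandermonde n (\row_(i < n) (i%:Z : int)).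
pose D := \prod_(p : 'I_n * 'I_n | lt_pair p && true) (p.2%:Z - p.1%:Z).
have detV : \det V = D.
  rewrite /V det_Vandermonde pair_big_dep /=; apply: eq_big => [p|p _].
    by rewrite andbT.
  by rewrite !mxE.
have detuV : \det (col_perm u V) = (-1) ^+ inversions u * D.
  have -> : col_perm u V = Vandermonde n (\row_(i < n) ((u i)%:Z : int)).
    by apply/matrixP => i j; rewrite !mxE.
  rewrite det_Vandermonde pair_big_dep /= /D.
  rewrite (@reindex_upair _ _ _ u xpredT) // -prodrXr.
  rewrite [X in _ * X](eq_bigl lt_pair); last by move=> p; rewrite andbT.
  rewrite -big_split /=; apply: eq_bigr => p _.
  rewrite !mxE /upair; case: (ltngtP (u p.1) (u p.2)) => [_|_|/ord_inj/perm_inj ->] /=.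
  - by rewrite expr0 mul1r.
  - by rewrite expr1 mulN1r opprB.
  - by rewrite subrr mulr0.
have D0 : D != 0.
  apply/prodf_neq0 => p /andP[lt_p _]; rewrite subr_eq0 eqz_nat.
  by rewrite gtn_eqF.
apply: (mulIf D0); rewrite -detuV -detV col_permE det_mulmx det_perm mulrC.
by rewrite odd_permV.
Qed.

End Pairs.

(** * Leading monomials *)

Section LeadBound.
Variables (n : nat) (R : nzRingType).
Implicit Types (m : 'X_{1..n}) (q : {mpoly R[n]}).

(* Allowing [c = 0] lets the bounds add up under products and sums with no
   nonvanishing hypothesis. *)
Definition lead_bound q m (c : R) := (mlead q <= m)%O /\ q@_m = c.

Lemma lead_bound_prod (I : Type) (r : seq I) (P : pred I)
    (F : I -> {mpoly R[n]}) (m : I -> 'X_{1..n}) (c : I -> R) :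
  (forall i, P i -> lead_bound (F i) (m i) (c i)) ->
  lead_bound (\prod_(i <- r | P i) F i) (\sum_(i <- r | P i) m i)%MM
    (\prod_(i <- r | P i) c i).
Proof.
move=> Fm; elim/big_rec3: _ => [|i c' m' q Pi [le_q cq]].
  by split; rewrite ?mlead1 ?mcoeff1 ?eqxx.
have [le_F cF] := Fm i Pi; split; last by rewrite mleadcMW // cF cq.
by apply: (le_trans (mleadM_le _ _)); apply: lem_add.
Qed.

Lemma lead_boundM q1 q2 m1 m2 c1 c2 :
  lead_bound q1 m1 c1 -> lead_bound q2 m2 c2 ->
  lead_bound (q1 * q2) (m1 + m2)%MM (c1 * c2).
Proof.
move=> [le1 e1] [le2 e2]; split; last by rewrite mleadcMW // e1 e2.
by apply: (le_trans (mleadM_le _ _)); apply: lem_add.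
Qed.

Lemma lead_boundZ a q m c : lead_bound q m c -> lead_bound (a *: q) m (a * c).
Proof.
move=> [le_q cq]; split; last by rewrite mcoeffZ cq.
exact: le_trans (mleadZ_le _ _) le_q.
Qed.

Lemma lead_bound_sum (I : Type) (r : seq I) (P : pred I)
    (F : I -> {mpoly R[n]}) m (c : I -> R) :
  (forall i, P i -> lead_bound (F i) m (c i)) ->
  lead_bound (\sum_(i <- r | P i) F i) m (\sum_(i <- r | P i) c i).
Proof.
move=> Fm; elim/big_rec2: _ => [|i c' q Pi [le_q cq]].
  by split; rewrite ?mlead0 ?le0x ?mcoeff0.
have [le_F cF] := Fm i Pi; split; last by rewrite mcoeffD cF cq.
by apply: (le_trans (mleadD_le _ _)); rewrite leUx le_F.
Qed.

Lemma lead_bound_mlead q m c : c != 0 -> lead_bound q m c -> mlead q = m.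
Proof.
move=> c0 [le_q cq]; apply/le_anti; rewrite le_q /=.
by apply: msupp_le_mlead; rewrite mcoeff_msupp cq.
Qed.

Lemma ltU_mnm (i j : 'I_n) : (i < j)%N -> (U_(j)%MM < U_(i)%MM :> 'X_{1..n})%O.
Proof.
move=> ltij; apply/ltmcP; rewrite ?mdeg1 //; exists i => [k ltki|].
  by rewrite !mnm1E !eqE /= (gtn_eqF ltki) (gtn_eqF (ltn_trans ltki ltij)).
by rewrite !mnm1E eqxx eqE /= (gtn_eqF ltij).
Qed.

(** The monomial order ranks variables of smaller index higher, so the leading term comes from
    whichever of i and j is smaller. *)
Lemma lead_bound_XB (a : R) (i j : 'I_n) : i != j ->
  lead_bound ('X_i - a *: 'X_j) U_(if (i < j)%N then i else j)
    (if (i < j)%N then 1 else - a).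
Proof.
move=> neij; split.
  apply: (le_trans (mleadB_le _ _)); rewrite leUx.
  have leZ : (mlead (a *: 'X_j : {mpoly R[n]}) <= U_(j)%MM)%O.
    by rewrite (le_trans (mleadZ_le _ _)) ?mleadXm.
  case: (ltngtP i j) => [lt|lt|/ord_inj E]; last by rewrite E eqxx in neij.
    by rewrite mleadXm lexx /= (le_trans leZ) // ltW // ltU_mnm.
  by rewrite leZ andbT mleadXm ltW // ltU_mnm.
rewrite mcoeffB mcoeffZ !mcoeffX.
have U_eq (k k' : 'I_n) : (U_(k) == U_(k'))%MM = (k == k').
  apply/eqP/eqP => [/mnmP/(_ k)|-> //]; rewrite !mnm1E eqxx.
  by case: eqP.
have Uij : (U_(i) == U_(j))%MM = false by rewrite U_eq (negPf neij).
have Uji : (U_(j) == U_(i))%MM = false by rewrite eq_sym.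
by case: ifP => _; rewrite !eqxx ?Uij ?Uji ?mulr0 ?mulr1 ?subr0 ?sub0r.
Qed.

End LeadBound.

(** * Alternating sums *)

Section Alternation.
Variables (n : nat) (R : idomainType).
Implicit Types (u v : 'S_n) (p : 'I_n * 'I_n) (e : pred ('I_n * 'I_n)) (a : R).
Implicit Types f : {mpoly R[n]}.

Definition pair_prod a e : {mpoly R[n]} :=
  \prod_(p : 'I_n * 'I_n | lt_pair p && e p) ('X_p.1 - a *: 'X_p.2).

(** For [e = xpredT] this is the staircase (n-1, ..., 1, 0). *)
Definition pair_rho e : 'X_{1..n} :=
  (\sum_(p : 'I_n * 'I_n | lt_pair p && e p) U_(p.1))%MM.

Lemma msym_XU u i : msym u 'X_i = 'X_(u i) :> {mpoly R[n]}.
Proof. by rewrite /msym mmapX mmap1U. Qed.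

Lemma msym_pair_prod u a e : msym u (pair_prod a e) =
  \prod_(p : 'I_n * 'I_n | lt_pair p && e p) ('X_(u p.1) - a *: 'X_(u p.2)).
Proof.
by rewrite rmorph_prod; apply: eq_bigr => p _ /=; rewrite msymB msymZ !msym_XU.
Qed.

(** Each factor leads with the smaller of its two indices, and [u] permutes the unordered pairs
    selected by [e]; hence the bound [pair_rho e] is the same for all such [u]. *)
Lemma lead_bound_pair_prod u a e : upair_invariant u e ->
  lead_bound (msym u (pair_prod a e)) (pair_rho e)
    (\prod_(p : 'I_n * 'I_n | lt_pair p && e p)
        if (u p.1 < u p.2)%N then 1 else - a).
Proof.
move=> inv_e; rewrite msym_pair_prod /pair_rho [X in lead_bound _ X](reindex_upair _ _ inv_e).
apply: lead_bound_prod => p /andP[lt_p _].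
have -> : (upair u p).1 = if (u p.1 < u p.2)%N then u p.1 else u p.2.
  by rewrite /upair; case: ifP.
apply: lead_bound_XB; rewrite (inj_eq perm_inj).
by apply: contraTneq lt_p => E; rewrite /lt_pair E ltnn.
Qed.

Lemma upair_invariant1 e :
  (forall i j, e (j, i) = e (i, j)) -> upair_invariant 1 e.
Proof. by move=> sym_e i j; split; rewrite ?perm1. Qed.

Lemma lead_bound_vandermonde e : (forall i j, e (j, i) = e (i, j)) ->
  lead_bound (pair_prod 1 e) (pair_rho e) 1.
Proof.
move=> sym_e; have := lead_bound_pair_prod 1 (upair_invariant1 sym_e).
rewrite msym1m big1 // => p /andP[lt_p _].
by rewrite !perm1 [(_ < _)%N]lt_p.
Qed.

Lemma vandermonde_neq0 e : (forall i j, e (j, i) = e (i, j)) ->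
  pair_prod 1 e != 0.
Proof.
move=> /lead_bound_vandermonde[_ coefV].
by apply: contra_eq_neq coefV => ->; rewrite mcoeff0 eq_sym oner_neq0.
Qed.

Lemma msym_vandermonde u :
  msym u (pair_prod 1 xpredT) = (-1) ^+ u *: pair_prod 1 xpredT.
Proof.
rewrite scaler_sign -mulr_sign -odd_inversions -prodrXr msym_pair_prod /pair_prod.
rewrite [X in _ * X](@reindex_upair _ _ _ _ u xpredT) //.
rewrite [X in _ * X](eq_bigl (lt_pair (n := n))) => [|p]; last by rewrite andbT.
rewrite -big_split /=; apply: eq_big => [p|p _]; first by rewrite andbT.
rewrite !scale1r /upair; case: (ltngtP (u p.1) (u p.2)) => [_|_|/ord_inj ->] /=.
- by rewrite mul1r.
- by rewrite mulN1r opprB.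
- by rewrite subrr mulr0.
Qed.

Lemma prod_sign_inversions u a :
  \prod_(p : 'I_n * 'I_n | lt_pair p) (if (u p.1 < u p.2)%N then 1 else - a) =
  (- a) ^+ inversions u.
Proof.
rewrite -prodrXr; apply: eq_bigr => p lt_p.
case: ltngtP => [||/ord_inj/perm_inj E]; rewrite ?expr0 ?expr1 //.
by rewrite /lt_pair E ltnn in lt_p.
Qed.

Lemma signr_inversions u a :
  (-1) ^+ u * (- a) ^+ inversions u = a ^+ inversions u.
Proof.
by rewrite -odd_inversions -exprMn mulN1r opprK.
Qed.

Definition alternate f := \sum_(u : 'S_n) (-1) ^+ u *: msym u f.

Lemma alternateZ a f : alternate (a *: f) = a *: alternate f.
Proof.
rewrite scaler_sumr; apply: eq_bigr => u _.
by rewrite msymZ !scalerA mulrC.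
Qed.

Lemma alternate_sum (I : Type) (r : seq I) (P : pred I) F :
  alternate (\sum_(i <- r | P i) F i) = \sum_(i <- r | P i) alternate (F i).
Proof.
rewrite /alternate exchange_big; apply: eq_bigr => u _.
by rewrite (raddf_sum (msym u)) scaler_sumr.
Qed.

Lemma alternate_msym u f : alternate (msym u f) = (-1) ^+ u *: alternate f.
Proof.
rewrite /alternate [X in _ = _ *: X](reindex_inj (mulgI u)) scaler_sumr.
apply: eq_bigr => v _; rewrite scalerA msymMm; congr (_ *: _).
by rewrite odd_permM signr_addb mulrA -expr2 sqrr_sign mul1r.
Qed.

Lemma msym_alternate u f : msym u (alternate f) = (-1) ^+ u *: alternate f.
Proof.
rewrite /alternate [X in _ = _ *: X](reindex_inj (mulIg u)) scaler_sumr.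
rewrite (raddf_sum (msym u)).
apply: eq_bigr => v _; rewrite /= msymZ scalerA msymMm; congr (_ *: _).
by rewrite odd_permM signr_addb mulrCA -expr2 sqrr_sign mulr1.
Qed.

End Alternation.

(** * The numerator of the classical Hall-Littlewood polynomial *)

Section HallLittlewoodNumerator.
Variables (n : nat) (R : idomainType) (t : R) (l : 'I_n -> nat).
Hypothesis two_neq0 : 2%:R != 0 :> R.
Hypothesis l_dec : forall i j : 'I_n, (i <= j)%N -> (l j <= l i)%N.
Implicit Types (u v : 'S_n) (p : 'I_n * 'I_n).

Definition level_stab : {set 'S_n} := [set u : 'S_n | [forall i, l (u i) == l i]].

Definition same_level p := l p.1 == l p.2.

Definition level_mnm : 'X_{1..n} := [multinom l i | i < n].

Definition stab_poincare : R := \sum_(u in level_stab) t ^+ inversions u.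

(** The symmetrized Hall-Littlewood sum cleared of its Vandermonde denominator, which turns it into
    an alternating sum. *)
Definition HL_alternant : {mpoly R[n]} :=
  alternate ('X_[level_mnm] * pair_prod t xpredT).

Lemma level_stabP u : reflect (forall i, l (u i) = l i) (u \in level_stab).
Proof. by rewrite inE; apply: (iffP forallP) => H i; apply/eqP. Qed.

Lemma level_stabMr u v : v \in level_stab -> (u * v \in level_stab)%g = (u \in level_stab).
Proof.
move/level_stabP => lv; apply/level_stabP/level_stabP => H i.
  by rewrite -(H i) permM lv.
by rewrite permM lv.
Qed.

Lemma same_level_invariant u : u \in level_stab -> upair_invariant u same_level.
Proof.
by move/level_stabP => lu i j; rewrite /same_level /= !lu eq_sym.
Qed.

(** The left side changes sign under transpositions inside a level set, so it is a multiple of the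
    product on the right. Both sides have the same bound on their leading monomial, so the cofactor
    is a constant, read off at [pair_rho same_level]. *)
Lemma alternate_same_level :
  \sum_(u in level_stab) (-1) ^+ u *: msym u (pair_prod t same_level) =
  stab_poincare *: pair_prod 1 same_level.
Proof.
set T := LHS; have symL i j : same_level (j, i) = same_level (i, j) by apply: eq_sym.
have boundT : lead_bound T (pair_rho same_level) stab_poincare.
  rewrite /stab_poincare; under eq_bigr do rewrite -signr_inversions.
  apply: lead_bound_sum => u Wu; apply: lead_boundZ.
  (* Since [l] is decreasing, an element of [level_stab] has no inversion between different levels,
     so those pairs contribute 1. *)
  rewrite -prod_sign_inversions (bigID same_level) /=.
  rewrite [X in _ * X]big1 ?mulr1 => [|p /andP[lt_p ne_l]].
    exact: lead_bound_pair_prod (same_level_invariant Wu).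
  have /level_stabP lu := Wu; case: ltnP => // /l_dec; rewrite !lu => le_l.
  by case/negP: ne_l; rewrite /same_level eqn_leq le_l l_dec // ltnW.
have skewT p : (p.1 < p.2)%N -> same_level p -> msym (tperm p.1 p.2) T = - T.
  move=> lt_p /eqP lp; set v := tperm _ _.
  have Wv : v \in level_stab.
    by apply/level_stabP => i; rewrite /v; case: tpermP => [->|->|].
  have odd_v : odd_perm v = true.
    by rewrite /v odd_tperm -(inj_eq val_inj) ltn_eqF.
  rewrite {2}/T (reindex_inj (mulIg v)) /=.
  rewrite [LHS](raddf_sum (msym v)) -sumrN; apply: eq_big => u /=.
    by rewrite level_stabMr.
  move=> _; rewrite msymZ -msymMm -scaleNr odd_permM odd_v signr_addb expr1.
  by rewrite mulrN1 opprK.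
have [q] := @skew_dvd _ _ same_level T two_neq0 skewT.
rewrite (_ : \prod_(p : 'I_n * 'I_n | _) _ = pair_prod 1 same_level); last first.
  by apply: eq_bigr => p _; rewrite scale1r.
have boundV := lead_bound_vandermonde R symL.
have V0 := vandermonde_neq0 R symL.
(* A [lead_bound] coefficient may vanish: if [q] is 0, then so is [stab_poincare]. *)
have [-> | q0] := eqVneq q 0 => ET.
  move: boundT.2; rewrite ET mulr0 mcoeff0 => <-; by rewrite scale0r.
have q_const : mlead q = 0%MM.
  apply/le_anti; rewrite le0x andbT; move: boundT.1.
  rewrite ET mleadM // (lead_bound_mlead _ boundV) ?oner_neq0 //.
  by rewrite -[X in (_ <= X)%O]addm0 lemc_add2r.
have q_C : q = (q@_0%MM)%:MP.
  by apply: msize1_polyC; rewrite -mlead_deg // q_const mdeg0.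
have := boundT.2; rewrite ET q_C mulrC mul_mpolyC mcoeffZ boundV.2 mulr1 => ->.
by [].
Qed.

(** For decreasing [l], the increasing pairs across levels are exactly those with l j < l i, a
    condition that [u] preserves. *)
Lemma pair_prod_cross u : u \in level_stab ->
  msym u (pair_prod t (predC same_level)) = pair_prod t (predC same_level).
Proof.
move/level_stabP => lu.
have crossE p : lt_pair p && ~~ same_level p = (l p.2 < l p.1)%N.
  rewrite /lt_pair /same_level; apply/andP/idP => [[lt_p ne_l]|lt_l].
    by rewrite ltn_neqAle eq_sym ne_l l_dec // ltnW.
  split; last by rewrite eq_sym ltn_eqF.
  by rewrite ltnNge; apply: contraL lt_l => /l_dec; rewrite -leqNgt.
rewrite msym_pair_prod /pair_prod !(eq_bigl _ _ crossE).
rewrite [RHS](reindex (fun p => (u p.1, u p.2))) /=; last first.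
  by exists (fun p => (u^-1 p.1, u^-1 p.2)%g) => -[i j] _ /=; rewrite ?permK ?permKV.
by apply: eq_bigl => p; rewrite !lu.
Qed.

Lemma msym_level_mnm u : u \in level_stab ->
  msym u 'X_[level_mnm] = 'X_[level_mnm] :> {mpoly R[n]}.
Proof.
move/level_stabP => lu; rewrite msymX; congr 'X_[_]; apply/mnmP => i.
by rewrite !mnmE -[in LHS]lu permKV.
Qed.

Lemma pair_prod_split a e : pair_prod a xpredT =
  pair_prod a e * pair_prod a (predC e) :> {mpoly R[n]}.
Proof.
rewrite /pair_prod (bigID e) /=; congr (_ * _); apply: eq_bigl => p;
by rewrite andbT.
Qed.

(** Up to the factor [#|level_stab|], this is the quotient of [HL_alternant] by [stab_poincare]. *)
Definition reduced_alternant : {mpoly R[n]} :=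
  alternate ('X_[level_mnm] * pair_prod 1 same_level
             * pair_prod t (predC same_level)).

(* Both sides antisymmetrize [sum_(u in level_stab) sgn(u) u F], where [F] is
   the argument of [alternate] in [HL_alternant]. *)
Lemma HL_alternant_reduced :
  #|level_stab|%:R *: HL_alternant = stab_poincare *: reduced_alternant.
Proof.
rewrite /reduced_alternant -alternateZ.
have -> : stab_poincare *: ('X_[level_mnm] * pair_prod 1 same_level *
    pair_prod t (predC same_level)) =
  \sum_(u in level_stab) (-1) ^+ u *: msym u ('X_[level_mnm] * pair_prod t xpredT).
  rewrite scalerAl scalerAr -alternate_same_level mulr_sumr mulr_suml.
  apply: eq_bigr => u Wu; rewrite (pair_prod_split t same_level) !msymM.
  by rewrite msym_level_mnm // pair_prod_cross // mulrA scalerAl scalerAr.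
rewrite alternate_sum scaler_nat -sumr_const; apply: eq_bigr => u _.
by rewrite alternateZ alternate_msym scalerA -expr2 sqrr_sign scale1r.
Qed.

(** Otherwise let i be the first place where the permuted exponents differ, so that l i < l (u i).
    The set [A] of indices of level above l i would be properly contained in its preimage under [u],
    which has the same size. *)
Lemma perm_level_mnm_le u :
  ([multinom level_mnm (u i) | i < n] <= level_mnm)%O.
Proof.
rewrite leNgt; apply/negP => /ltmcP -[|i eq_lt lt_i].
  by rewrite mdeg_mperm.
pose A := [set j | (l i < l j)%N].
have : (#|A| < #|u @^-1: A|)%N.
  apply: proper_card; apply/properP; split.
    apply/fintype.subsetP => j; rewrite !inE => ltij.
    have ltji : (j < i)%N by rewrite ltnNge; apply: contraL ltij => /l_dec; rewrite -leqNgt.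
    by move: (eq_lt j ltji); rewrite !mnmE => <-.
  exists i; rewrite !inE ?ltnn //.
  by move: lt_i; rewrite !mnmE.
by rewrite card_preimset ?ltnn //; apply: perm_inj.
Qed.

(** All permuted pair products are bounded at rho, and the permuted level monomial equals
    [level_mnm] only for [u] in [level_stab]; there the two signs cancel and leave
    [t ^+ inversions u]. *)
Lemma lead_bound_HL_alternant :
  lead_bound HL_alternant (level_mnm + pair_rho xpredT)%MM stab_poincare.
Proof.
have -> : stab_poincare = \sum_(u : 'S_n)
    (-1) ^+ u * ((u \in level_stab)%:R * (- t) ^+ inversions u).
  rewrite /stab_poincare big_mkcond; apply: eq_bigr => u _.
  by case: ifP; rewrite ?mul0r ?mulr0 // mul1r signr_inversions.
apply: lead_bound_sum => u _; apply: lead_boundZ; rewrite msymM.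
apply: lead_boundM; last first.
  rewrite -prod_sign_inversions.
  have := @lead_bound_pair_prod _ _ u t xpredT.
  by under eq_bigl do rewrite andbT; apply.
rewrite msymX; split; first by rewrite mleadXm perm_level_mnm_le.
rewrite mcoeffX; congr (nat_of_bool _)%:R; apply/eqP/level_stabP => [E i|lu].
  by move/mnmP/(_ (u i)): E; rewrite !mnmE permK.
by apply/mnmP => i; rewrite !mnmE -[in LHS]lu permKV.
Qed.

(** Cancelling [stab_poincare] shows that [q] is antisymmetric, hence a multiple of the Vandermonde
    product. Dividing the leading term at la + rho by the one at rho leaves la with coefficient
    1. *)
Lemma HL_quotient q : stab_poincare != 0 -> HL_alternant = stab_poincare *: q ->
  exists2 P, q = pair_prod 1 xpredT * P & P@_level_mnm = 1.
Proof.
move=> W0 Eq.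
have skew_q p : (p.1 < p.2)%N -> xpredT p -> msym (tperm p.1 p.2) q = - q.
  move=> lt_p _.
  have/mpolyP E : stab_poincare *: msym (tperm p.1 p.2) q = stab_poincare *: - q.
    rewrite -msymZ scalerN -Eq msym_alternate odd_tperm -(inj_eq val_inj).
    by rewrite ltn_eqF // expr1 scaleN1r.
  by apply/mpolyP => m; apply: (mulfI W0); rewrite -!mcoeffZ.
have [P] := skew_dvd two_neq0 skew_q.
rewrite (_ : \prod_(p : 'I_n * 'I_n | _) _ = pair_prod 1 xpredT); last first.
  by apply: eq_bigr => p _; rewrite scale1r.
move=> EP; exists P => //.
have boundV := @lead_bound_vandermonde n R xpredT (fun _ _ => erefl).
have leadV := lead_bound_mlead (oner_neq0 _) boundV.
have leadS := lead_bound_mlead W0 lead_bound_HL_alternant.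
have coefS := lead_bound_HL_alternant.2.
have q_nz : q != 0.
  by apply: contraNneq W0 => q0; rewrite -coefS Eq q0 scaler0 mcoeff0.
have V0 := @vandermonde_neq0 n R xpredT (fun _ _ => erefl).
have P0 : P != 0 by apply: contraNneq q_nz => P0; rewrite EP P0 mulr0.
have leadP : mlead P = level_mnm.
  move: leadS; rewrite Eq mleadZ // EP mleadM // leadV addmC => /eqP.
  by rewrite eqm_add2r => /eqP.
apply: (mulfI W0); rewrite mulr1 -[RHS]coefS Eq mcoeffZ EP addmC.
by rewrite mleadcMW ?leadV ?leadP // boundV.2 mul1r.
Qed.

End HallLittlewoodNumerator.

(** * Poincare polynomials of stabilizers *)

Section QFactorial.
Variables (R : idomainType) (t : R).

Definition qfact m : R := \prod_(1 <= i < m.+1) \sum_(j < i) t ^+ j.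

Lemma qfactS m : qfact m.+1 = (\sum_(j < m.+1) t ^+ j) * qfact m.
Proof. by rewrite /qfact big_nat_recr //= mulrC. Qed.

(** This is v_la(t) when [s] is la padded with zeros. *)
Definition multiplicity_qfact (s : seq nat) : R :=
  \prod_(a <- undup s) qfact (count_mem a s).

Lemma multiplicity_qfact_cons a s : multiplicity_qfact (a :: s) =
  (\sum_(j < (count_mem a s).+1) t ^+ j) * multiplicity_qfact s.
Proof.
rewrite /multiplicity_qfact /=; case: (boolP (a \in s)) => as_.
  rewrite (bigD1_seq a) ?mem_undup ?undup_uniq //=.
  rewrite [in RHS](bigD1_seq a) ?mem_undup ?undup_uniq //=.
  rewrite eqxx add1n qfactS -mulrA; congr (_ * (_ * _)).
  by apply: eq_bigr => b /negPf; rewrite eq_sym => ->.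
rewrite big_cons eqxx add1n qfactS (count_memPn as_) [qfact 0]/qfact big_geq // mulr1.
congr (_ * _); apply: eq_big_seq => b; rewrite mem_undup => bs.
by case: eqP as_ => // ->; rewrite bs.
Qed.

(** A permutation of n+1 points amounts to the image k of 0 and a permutation of the remaining n
    points. *)
Lemma sum_lift_perm n (F : 'S_n.+1 -> R) :
  \sum_u F u = \sum_k \sum_(v : 'S_n) F (lift_perm ord0 k v).
Proof.
rewrite pair_big /=.
rewrite (reindex (fun kv : 'I_n.+1 * 'S_n => lift_perm ord0 kv.1 kv.2)) //.
apply: onW_bij; apply: inj_card_bij => [[k v] [k' v'] /= E|].
  have Ek : k = k' by rewrite -(lift_perm_id ord0 k v) E lift_perm_id.
  rewrite -Ek in E *; congr (_, _); apply/permP => i; apply: (@lift_inj _ k).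
  by rewrite -!(lift_perm_lift ord0) E.
by rewrite card_prod card_ord !card_Sn factS.
Qed.

Lemma inversions_pair n (u : 'S_n) :
  inversions u = (\sum_(i < n) \sum_(j < n | i < j) (u j < u i))%N.
Proof. by rewrite pair_big_dep. Qed.

Lemma sum_ord_lt n (k : nat) : (\sum_(j < n) (j < k) = minn k n)%N.
Proof.
elim: n => [|n IHn]; first by rewrite big_ord0 minn0.
by rewrite big_ord_recr /= IHn; lia.
Qed.

(** The point 0 forms an inversion with each of the k values below its image; the other points keep
    the relative order given by [v]. *)
Lemma inversions_lift_perm n (k : 'I_n.+1) (v : 'S_n) :
  inversions (lift_perm ord0 k v) = (k + inversions v)%N.
Proof.
rewrite !inversions_pair big_ord_recl; congr (_ + _)%N.
  rewrite big_mkcond big_ord_recl /= add0n lift_perm_id.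
  rewrite -[RHS](minn_idPl (_ : k <= n)%N) -1?ltnS // -sum_ord_lt.
  rewrite [RHS](reindex_inj (@perm_inj _ v)); apply: eq_bigr => j _.
  rewrite lift_perm_lift /= /bump.
  by case: (leqP k (v j)) => le_k /=; rewrite ?add0n ?add1n //; lia.
apply: eq_bigr => i _; rewrite big_mkcond big_ord_recl /= add0n.
rewrite [RHS]big_mkcond; apply: eq_bigr => j _.
rewrite !lift_perm_lift /= /bump !add1n ltnS; case: ifP => // _.
by do 2!case: leqP => ?; rewrite ?add0n ?add1n ?ltnS //; congr nat_of_bool; lia.
Qed.

Lemma nth_sorted_geq_eq a s k : sorted geq s -> all (geq a) s -> (k < size s)%N ->
  (nth 0%N s k == a) = (k < count_mem a s)%N.
Proof.
elim: s k => //= b s IHs k; rewrite (path_sortedE (rev_trans leq_trans)).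
case/andP=> le_s_b sort_s /andP[le_ba le_sa]; case: (b =P a) => [Eba|/eqP neba].
  by case: k => [|k] /= ltk; [rewrite Eba eqxx | rewrite add1n ltnS IHs].
have lt_ba : (b < a)%N by rewrite ltn_neqAle neba.
have as_ : a \notin s by apply/negP => /(allP le_s_b) /=; rewrite leqNgt lt_ba.
rewrite (count_memPn as_) ltn0 => ltk; apply/negP => /eqP E.
have : a \in b :: s by rewrite -E mem_nth.
by rewrite inE (negPf as_) orbF eq_sym (negPf neba).
Qed.

(** The indices of level l 0 form an initial segment, so if k lies in it, omitting k or omitting 0
    leaves the same sequence of levels. *)
Lemma lift_level_stab n (k : 'I_n.+1) (v : 'S_n) (l : 'I_n.+1 -> nat) :
  (forall i j : 'I_n.+1, (i <= j)%N -> (l j <= l i)%N) ->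
  (lift_perm ord0 k v \in level_stab l) =
  (l k == l ord0) && (v \in level_stab (fun i => l (lift ord0 i))).
Proof.
move=> l_dec.
have lift_k (j : 'I_n) : l k = l ord0 -> l (lift k j) = l (lift ord0 j).
  move=> Ek; have l0 (i : 'I_n.+1) : (i <= k)%N -> l i = l ord0.
    by move=> le_ik; apply/eqP; rewrite eqn_leq l_dec //= -Ek l_dec.
  case: (leqP k j) => lekj; last first.
    by rewrite (l0 (lift k j)) ?(l0 (lift ord0 j)) //= /bump; lia.
  by congr l; apply: val_inj; rewrite /= /bump lekj.
apply/level_stabP/andP => [H|[/eqP Ek /level_stabP H] i].
  have Ek : l k = l ord0 by rewrite -(H ord0) lift_perm_id.
  rewrite Ek; split=> //; apply/level_stabP => i.
  by rewrite -lift_k // -(lift_perm_lift ord0) H.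
case: (unliftP ord0 i) => [j|] ->; last by rewrite lift_perm_id.
by rewrite lift_perm_lift lift_k.
Qed.

(** Induction on [s], sorting the stabilizer by the image k of 0. The admissible k are the first c
    positions, c being the multiplicity of the largest entry, and they contribute the factor 1 + t +
    ... + t^(c-1). *)
Lemma stab_poincareE (s : seq nat) n : sorted geq s -> size s = n ->
  stab_poincare t (fun i : 'I_n => nth 0%N s i) = multiplicity_qfact s.
Proof.
elim: s n => [|a s IHs] [|n] //= sort_as.
  move=> _; rewrite /stab_poincare /multiplicity_qfact big_nil.
  rewrite (big_pred1 1%g) => [|u]; last first.
    have -> : u = 1%g by apply/permP => -[].
    by rewrite /= eqxx; apply/level_stabP => -[].
  by rewrite /inversions big1 ?expr0 // => -[[]].
move=> [szs]; have sort_s := path_sorted sort_as.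
have l_dec (i j : 'I_n.+1) : (i <= j)%N -> (nth 0%N (a :: s) j <= nth 0%N (a :: s) i)%N.
  move=> leij; apply: (sorted_leq_nth (rev_trans leq_trans) leqnn) => //;
  by rewrite inE /= szs ltn_ord.
rewrite multiplicity_qfact_cons -(IHs n) // /stab_poincare big_mkcond sum_lift_perm.
have le_a : all (geq a) (a :: s).
  rewrite /= leqnn; move: sort_as; rewrite (path_sortedE (rev_trans leq_trans)).
  by case/andP.
pose c := (count_mem a (a :: s)).
have le_c : (c <= n.+1)%N by rewrite -szs (count_size _ (a :: s)).
transitivity (\sum_(k < n.+1 | (k < c)%N) \sum_(v in
    level_stab (fun i : 'I_n => nth 0%N s i)) t ^+ (k + inversions v)).
  rewrite [RHS]big_mkcond; apply: eq_bigr => k _; rewrite [in RHS]big_mkcond.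
  rewrite /c -(@nth_sorted_geq_eq a (a :: s) k sort_as le_a) ?[size _]/= ?szs //.
  case: ifP => Ek; last first.
    by rewrite big1 // => v _; rewrite lift_level_stab //= Ek.
  apply: eq_bigr => v _; rewrite lift_level_stab //= Ek /=.
  by rewrite inversions_lift_perm.
rewrite -(big_ord_widen _ (fun k => \sum_(v in level_stab _) t ^+ (k + inversions v))) //.
rewrite /c /= eqxx add1n mulr_suml; apply: eq_bigr => k _.
by rewrite mulr_sumr; apply: eq_bigr => v _; rewrite exprD.
Qed.

End QFactorial.

(** * Hall-Littlewood polynomials *)

Section MonicDivisibility.
Implicit Types d p q : {poly int}.

(** A multiple of the remainder of [p] by [d] is divisible by [d] yet of smaller degree, so the
    remainder is 0. This removes the group order over the integers. *)
Lemma monic_dvd_mulrn d p q k : d \is monic -> (0 < k)%N ->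
  p *+ k = d * q -> exists r, p = d * r.
Proof.
move=> mon_d k0 E; exists (Pdiv.Ring.rdivp p d).
set r := Pdiv.Ring.rdivp p d; set m := Pdiv.Ring.rmodp p d.
have Ep : p = r * d + m by exact: Pdiv.RingMonic.rdivp_eq.
have d0 : d != 0 := monic_neq0 mon_d.
have lt_m : (size m < size d)%N by apply: Pdiv.Ring.ltn_rmodpN0.
have Em : m *+ k = d * (q - r *+ k).
  by rewrite mulrBr -E Ep mulrnDl mulrnAr [d * r]mulrC addrAC subrr add0r.
suff m0 : m = 0 by rewrite Ep m0 addr0 mulrC.
have k0' : (k%:R : int) != 0 by rewrite Num.Theory.pnatr_eq0 -lt0n.
rewrite -scaler_nat in Em.
have [z|nz] := eqVneq (q - r *+ k) 0.
  by move/eqP: Em; rewrite z mulr0 -mul_polyC mulf_eq0 polyC_eq0 (negPf k0') /= => /eqP.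
have := congr1 (fun f : {poly int} => size f) Em.
rewrite size_scale // size_monicM // => Es; move: lt_m; rewrite Es.
by rewrite -size_poly_gt0 in nz; lia.
Qed.

Lemma mpoly_monic_dvd_mulrn n d (f g : {mpoly {poly int}[n]}) k :
  d \is monic -> (0 < k)%N -> f *+ k = d *: g -> exists h, f = d *: h.
Proof.
move=> mon_d k0 E.
have dvd_coef m : exists r, f@_m == d * r.
  have [|r ->] := @monic_dvd_mulrn d f@_m g@_m k mon_d k0; last by exists r.
  by rewrite -mcoeffMn E mcoeffZ.
exists (\sum_(m <- msupp f) xchoose (dvd_coef m) *: 'X_[m]).
rewrite [LHS]mpolyE scaler_sumr; apply: eq_bigr => m _.
by rewrite scalerA -(eqP (xchooseP (dvd_coef m))).
Qed.

Lemma multiplicity_qfact_X_monic s : multiplicity_qfact ('X : {poly int}) s \is monic.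
Proof.
apply: monic_prod => a _; rewrite /qfact big_seq.
apply: monic_prod => -[|i]; rewrite mem_index_iota // => _.
have -> : \sum_(j < i.+1) 'X^j = \poly_(j < i.+1) 1 :> {poly int}.
  by rewrite poly_def; apply: eq_bigr => j _; rewrite scale1r.
by rewrite monicE lead_coef_poly ?oner_eq0.
Qed.

End MonicDivisibility.

(** * Integrality and leading coefficient of the Hall-Littlewood polynomial *)

Section HallLittlewoodPolynomial.
Variables (n : nat) (la : seq nat).
Hypotheses (la_sorted : sorted geq la) (la_size : (size la <= n)%N).

Local Notation "p %:F" := (FracField.tofrac p).
Local Notation A := {mpoly {poly int}[n]}.
Local Notation t := ('X : {poly int}).
Let l (i : 'I_n) : nat := nth 0%N la i.
Let padded := [seq nth 0%N la i | i <- iota 0 n].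

Lemma size_padded : size padded = n.
Proof. by rewrite size_map size_iota. Qed.

Lemma nth_padded i : (i < n)%N -> nth 0%N padded i = nth 0%N la i.
Proof. by move=> lt_i; rewrite (nth_map 0%N) ?size_iota // nth_iota. Qed.

Lemma nth_dec i j : (i <= j)%N -> (nth 0%N la j <= nth 0%N la i)%N.
Proof.
move=> leij; have [szj|ltj] := leqP (size la) j; first by rewrite nth_default.
apply: (sorted_leq_nth (rev_trans leq_trans) leqnn) => //; rewrite inE //.
exact: leq_ltn_trans ltj.
Qed.

Lemma padded_sorted : sorted geq padded.
Proof.
apply: (homo_sorted (e := leq)); last exact: iota_sorted.
exact: nth_dec.
Qed.

Lemma stab_poincare_padded : stab_poincare t l = multiplicity_qfact t padded.
Proof.
rewrite -(@stab_poincareE _ t padded n padded_sorted size_padded).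
have El : l = (fun i : 'I_n => nth 0%N padded i).
  by apply: boolp.funext => i; rewrite nth_padded.
by rewrite El.
Qed.

Lemma HL_t1_neq0 : 1 - HL_t n != 0.
Proof.
rewrite -tofrac1 -tofracB tofrac_eq0 -mpolyC1 -mpolyCB mpolyC_eq0.
by rewrite -oppr_eq0 opprB polyXsubC_eq0.
Qed.

Lemma HL_vE m : HL_v n m = (qfact t m)%:MP%:F :> {fraction A}.
Proof.
have step i : (1 - HL_t n ^+ i) / (1 - HL_t n) = (\sum_(j < i) t ^+ j)%:MP%:F.
  apply: (canLR (mulfK HL_t1_neq0)).
  rewrite -tofracXn -!tofrac1 -!tofracB -tofracM; congr (_%:F).
  rewrite -mpolyC1 -rmorphXn -!mpolyCB -mpolyCM; congr (_%:MP).
  by rewrite -!(opprB _ 1) subrX1 mulrN mulrC.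
rewrite /HL_v /qfact; apply: (big_ind2 (fun x y => x = y%:MP%:F)) => //.
by move=> x1 y1 x2 y2 -> ->; rewrite mpolyCM tofracM.
Qed.

Lemma HL_vpartE : HL_vpart n la = (multiplicity_qfact t padded)%:MP%:F :> {fraction A}.
Proof.
rewrite /HL_vpart /multiplicity_qfact -/padded.
apply: (big_ind2 (fun x y => x = y%:MP%:F)) => [//|x1 y1 x2 y2 -> ->|a _].
  by rewrite mpolyCM tofracM.
exact: HL_vE.
Qed.

Lemma sign_cancel (K : fieldType) (b : bool) (x y z : K) : z != 0 ->
  x * (y / ((-1) ^+ b * z)) * z = (-1) ^+ b * (x * y).
Proof. by move=> z0; rewrite invfM invr_sign !mulrA mulfVK // mulrC mulrA. Qed.

(** Each [w] changes the Vandermonde product only by its sign, so all summands of [HL_frac] share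
    one denominator and the sum becomes alternating. *)
Lemma HL_fracE : HL_frac n la * ((multiplicity_qfact t padded)%:MP%:F * (pair_prod 1 xpredT)%:F) =
  (HL_alternant t l)%:F.
Proof.
rewrite /HL_frac HL_vpartE mulrACA mulVf ?mul1r; last first.
  by rewrite tofrac_eq0 mpolyC_eq0 monic_neq0 // multiplicity_qfact_X_monic.
rewrite mulr_suml /HL_alternant /alternate.
apply: (big_ind2 (fun x y => x = y%:F)) => [//|x1 y1 x2 y2 -> ->|w _].
  by rewrite tofracD.
have num : \prod_(i < n) HL_x (w i) ^+ nth 0%N la i = (msym w 'X_[level_mnm l])%:F.
  rewrite mpolyXE_id (big_morph _ (msymM w) (msym1 _ w)) (big_morph _ (@tofracM _) (tofrac1 _)).
  by apply: eq_bigr => i _; rewrite rmorphXn /= msym_XU tofracXn mnmE.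
have pairs a : \prod_(p : 'I_n * 'I_n | (p.1 < p.2)%N)
    (HL_x (w p.1) - a%:MP%:F * HL_x (w p.2)) = (msym w (pair_prod a xpredT))%:F.
  rewrite msym_pair_prod (big_morph _ (@tofracM _) (tofrac1 _)).
  apply: eq_big => [p|p _]; first by rewrite andbT.
  by rewrite -mul_mpolyC tofracB tofracM.
have pairs1 : \prod_(p : 'I_n * 'I_n | (p.1 < p.2)%N)
    (HL_x (w p.1) - HL_x (w p.2)) = (msym w (pair_prod 1 xpredT))%:F.
  by rewrite -pairs; apply: eq_bigr => p _; rewrite mpolyC1 tofrac1 mul1r.
have sgnE (f : A) : ((-1) ^+ w *: f)%:F = (-1) ^+ w * f%:F.
  by case: (odd_perm w); rewrite ?scaleN1r ?scale1r ?tofracN ?mulN1r ?mul1r.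
rewrite pair_big_dep /= num prodf_div (pairs t) pairs1 msym_vandermonde msymM.
rewrite !sgnE tofracM sign_cancel //.
by rewrite tofrac_eq0; exact: (@vandermonde_neq0 n _ xpredT).
Qed.

Lemma HL_poly_lead : (HL_poly n la)@_(level_mnm l) = 1.
Proof.
have mon := multiplicity_qfact_X_monic padded.
have two0 : 2%:R != 0 :> {poly int} by rewrite -polyC_natr polyC_eq0.
have W0 : stab_poincare t l != 0 by rewrite stab_poincare_padded monic_neq0.
have l_dec (i j : 'I_n) : (i <= j)%N -> (l j <= l i)%N by apply: nth_dec.
have [|||Q EQ] := @mpoly_monic_dvd_mulrn n (stab_poincare t l) (HL_alternant t l)
  (reduced_alternant t l) #|level_stab l|.
- by rewrite stab_poincare_padded.
- by apply/card_gt0P; exists 1%g; apply/level_stabP => i; rewrite perm1.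
- by rewrite -scaler_nat HL_alternant_reduced.
have [P EP leadP] := HL_quotient two0 l_dec W0 EQ.
(* [HL_poly] is a choice with default 0, so it is identified by exhibiting a polynomial with the
   right image in the fraction field. *)
suff /HL_poly_unique -> : P%:F = HL_frac n la by [].
have nz : ((multiplicity_qfact t padded)%:MP%:F * (pair_prod 1 xpredT)%:F : {fraction A}) != 0.
  rewrite mulf_eq0 !tofrac_eq0 mpolyC_eq0 (negPf (monic_neq0 mon)) /=.
  exact: (@vandermonde_neq0 n _ xpredT).
apply: (mulIf nz); rewrite HL_fracE EQ EP stab_poincare_padded.
by rewrite -mul_mpolyC !tofracM mulrC -!mulrA.
Qed.

Lemma HL_coef_diag : HL_coef n la la = 1.
Proof. exact: HL_poly_lead. Qed.

End HallLittlewoodPolynomial.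

(** * Triangular families *)

Section TriangularBasis.
Variables (R : nzRingType) (M : lmodType R) (I : finType).
Implicit Types (b m : I -> M) (f g : M).

Lemma lin_spanD b f g : lin_span b f -> lin_span b g -> lin_span b (f + g).
Proof.
move=> [a1 ->] [a2 ->]; exists (fun i => a1 i + a2 i); rewrite -big_split /=.
by apply: eq_bigr => i _; rewrite scalerDl.
Qed.

(** Membership is asked only for nonzero [c], so that triangularity hypotheses about nonzero
    coefficients apply. *)
Lemma lin_spanZ b (c : R) f : (c != 0 -> lin_span b f) -> lin_span b (c *: f).
Proof.
have [-> _|_ /(_ isT)[a ->]] := eqVneq c 0.
  by exists (fun=> 0); rewrite scale0r big1 // => i _; rewrite scale0r.
exists (fun i => c * a i); rewrite scaler_sumr.
by apply: eq_bigr => i _; rewrite scalerA.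
Qed.

Lemma lin_span_sum (J : Type) (s : seq J) (P : pred J) b (F : J -> M) :
  (forall j, P j -> lin_span b (F j)) -> lin_span b (\sum_(j <- s | P j) F j).
Proof.
move=> bF; apply: (big_ind (lin_span b)) => //; last exact: lin_spanD.
by exists (fun=> 0); rewrite big1 // => i _; rewrite scale0r.
Qed.

Lemma lin_span_mem b i : lin_span b (b i).
Proof.
exists (fun j => (j == i)%:R); rewrite (bigD1 i) //= eqxx scale1r big1 ?addr0 //.
by move=> j /negPf->; rewrite scale0r.
Qed.

(** For freeness, take an index of maximal rank among the nonzero coefficients: only the diagonal
    contributes there. For spanning, solve for [m i] by induction on rank. Inverses are two-sided
    because the ring may be noncommutative. *)
Lemma triangular_basis b m (r : I -> nat) (u : I -> R) (a : I -> I -> R) :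
  (forall c : I -> R, \sum_i c i *: m i = 0 -> forall i, c i = 0) ->
  (forall i, exists v, (u i * v = 1) /\ (v * u i = 1)) ->
  (forall i j, a i j != 0 -> (r j < r i)%N) ->
  (forall i, b i = u i *: m i + \sum_j a i j *: m j) ->
  is_basis (lin_span m) b.
Proof.
move=> free_m unit_u low_a Eb; split.
  move=> c; pose c' j := c j * u j + \sum_i c i * a i j.
  have -> : \sum_i c i *: b i = \sum_j c' j *: m j.
    under [RHS]eq_bigr do rewrite scalerDl scaler_suml.
    rewrite big_split exchange_big -big_split; apply: eq_bigr => i _ /=.
    rewrite Eb scalerDr scalerA scaler_sumr; congr (_ + _).
    by apply: eq_bigr => j _; rewrite scalerA.
  move=> /free_m c'0 i; apply/eqP; apply: contraT => ci.
  case: (@arg_maxnP _ i (fun j => c j != 0) r ci) => k ck max_k.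
  have := c'0 k; rewrite /c' big1 ?addr0 => [ck0|j _]; last first.
    have [->|cj] := eqVneq (c j) 0; first by rewrite mul0r.
    have [->|/low_a] := eqVneq (a j k) 0; first by rewrite mulr0.
    by rewrite ltnNge (max_k j cj : (r j <= r k)%N).
  have [v [uv _]] := unit_u k.
  by rewrite -[c k]mulr1 -uv mulrA ck0 mul0r eqxx in ck.
have span_m i : lin_span b (m i).
  have [k] := ubnP (r i); elim: k i => // k IHk i; rewrite ltnS => le_k.
  have [v [_ vu]] := unit_u i.
  have -> : m i = v *: (b i + \sum_j (- a i j) *: m j).
    rewrite Eb -addrA -big_split /= big1 ?addr0 => [|j _].
      by rewrite scalerA vu scale1r.
    by rewrite scaleNr subrr.
  apply: lin_spanZ => _; apply: lin_spanD; first exact: lin_span_mem.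
  apply: lin_span_sum => j _; apply: lin_spanZ; rewrite oppr_eq0 => aij.
  by apply: IHk; apply: leq_trans le_k; apply: low_a.
apply: boolp.funext => f; apply: boolp.propext; split => -[c ->].
  apply: lin_span_sum => i _; apply: lin_spanZ => _; rewrite Eb.
  apply: lin_spanD; first by apply: lin_spanZ => _; apply: lin_span_mem.
  by apply: lin_span_sum => j _; apply: lin_spanZ => _; apply: lin_span_mem.
by apply: lin_span_sum => i _; apply: lin_spanZ => _; apply: span_m.
Qed.

End TriangularBasis.

(** * Set partitions *)

Section SetPartitionAction.
Variable n : nat.
Implicit Types (d g w : 'S_n) (P : {set {set 'I_n}}) (pi si : setpart n).
Local Open Scope nat_scope.

Lemma pactM d g P : pact g (pact d P) = pact (d * g)%g P.
Proof.
rewrite /pact -imset_comp; apply: eq_imset => A /=.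
by rewrite -imset_comp; apply: eq_imset => i /=; rewrite permM.
Qed.

Lemma pact1 P : pact 1 P = P.
Proof.
rewrite /pact -[RHS]imset_id; apply: eq_imset => A.
by rewrite -[RHS]imset_id; apply: eq_imset => i; rewrite perm1.
Qed.

Lemma pact_partition d P :
  partition P [set: 'I_n] -> partition (pact d P) [set: 'I_n].
Proof.
move=> partP; have injd := @perm_inj _ d; have := partP.
rewrite -(imset_partition _ [set: 'I_n] injd) /pact; congr (partition _ _).
by apply/setP => i; rewrite inE -[i](permKV d) imset_f ?inE.
Qed.

Definition setpart_act d pi : setpart n := SetPart (pact_partition d (blocksP pi)).

Lemma setpart_actM d g pi :
  setpart_act g (setpart_act d pi) = setpart_act (d * g)%g pi.
Proof. by apply: val_inj; rewrite /= pactM. Qed.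

Lemma setpart_act1 pi : setpart_act 1 pi = pi.
Proof. by apply: val_inj; rewrite /= pact1. Qed.

Lemma geq_trans : transitive geq. Proof. exact: rev_trans leq_trans. Qed.

Lemma block_type_sorted pi : sorted geq (block_type pi).
Proof. by apply: sort_sorted => i j; exact: leq_total. Qed.

Lemma intpart_block_type pi : intpart n (block_type pi).
Proof.
rewrite /intpart block_type_sorted mem_sort /=; apply/andP; split.
  apply/mapP => -[A]; rewrite mem_enum => piA /esym/eqP; rewrite cards_eq0 => /eqP A0.
  by have /and3P[_ _ /negP[]] := blocksP pi; rewrite -A0.
rewrite (perm_sumn (permEl (perm_sort _ _))) sumnE big_map big_enum /=.
by rewrite -(card_partition (blocksP pi)) cardsT card_ord.
Qed.

Lemma intpart_size mu : intpart n mu -> size mu <= n.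
Proof.
case/and3P => _ + /eqP <-; elim: mu => //= a mu IHmu.
rewrite inE negb_or eq_sym -lt0n => /andP[a_gt0 /IHmu le_mu].
by rewrite -add1n leq_add.
Qed.

Lemma block_type_perm pi s :
  sorted geq s -> perm_eq s [seq #|A| | A : {set 'I_n} <- enum pi] ->
  block_type pi = s.
Proof.
move=> sort_s perm_s; apply: (sorted_eq geq_trans) => //.
- by move=> i j; rewrite andbC -eqn_leq => /eqP.
- exact: block_type_sorted.
- by rewrite perm_sort perm_sym.
Qed.

Lemma enum_imset_perm (T U : finType) (f : T -> U) (A : {pred T}) :
  {in A &, injective f} -> perm_eq (enum (f @: A)) [seq f x | x <- enum A].
Proof.
move=> injf; apply: uniq_perm; first exact: enum_uniq.
  by rewrite map_inj_in_uniq ?enum_uniq // => x y; rewrite !mem_enum; apply: injf.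
move=> y; rewrite mem_enum; apply/imsetP/mapP => -[x Ax ->]; exists x => //;
by rewrite mem_enum in Ax *.
Qed.

Lemma block_type_act d pi : block_type (setpart_act d pi) = block_type pi.
Proof.
apply: block_type_perm; first exact: block_type_sorted.
rewrite perm_sort perm_sym (perm_trans (perm_map _ (enum_imset_perm _))) //.
  by move=> A B _ _; apply/imset_inj/perm_inj.
rewrite -map_comp (eq_map (g := fun A : {set 'I_n} => #|A|)) //.
by move=> A /=; rewrite card_imset //; apply: perm_inj.
Qed.

Lemma sumn_take_leq s i j : i <= j -> sumn (take i s) <= sumn (take j s).
Proof. by move=> leij; rewrite -(subnKC leij) takeD sumn_cat leq_addr. Qed.

Lemma sumn_takeS s i : sumn (take i.+1 s) = sumn (take i s) + nth 0 s i.
Proof.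
have [lt_i|le_i] := ltnP i (size s); last first.
  by rewrite !take_oversize ?nth_default ?addn0 // leqW.
by rewrite (take_nth 0) // -cats1 sumn_cat /= addn0.
Qed.

Definition interval (mu : seq nat) k : {set 'I_n} :=
  [set i : 'I_n | sumn (take k mu) <= i < sumn (take k.+1 mu)].

Lemma intervalsE mu : intervals n mu = [set interval mu k | k : 'I_(size mu)].
Proof. by []. Qed.

Lemma card_interval mu k : sumn mu = n -> #|interval mu k| = nth 0 mu k.
Proof.
move=> sum_mu; have le_n j : sumn (take j mu) <= n.
  by rewrite -[X in _ <= X]sum_mu -[X in _ <= sumn X](cat_take_drop j) sumn_cat leq_addr.
have le_k := sumn_take_leq mu (leqnSn k).
(* Adding the positions before the interval reduces the count to initial segments. *)
rewrite -sum1_card big_mkcond /=; apply: (@addnI (sumn (take k mu))).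
rewrite -sumn_takeS -[RHS](minn_idPl (le_n _)) -sum_ord_lt.
rewrite -[X in X + _](minn_idPl (le_n _)) -sum_ord_lt -big_split /=.
apply: eq_bigr => i _; rewrite inE.
by case: (leqP (sumn (take k mu)) i) => ?; case: (ltnP i (sumn (take k.+1 mu))) => ? //=; lia.
Qed.

Lemma interval_inj mu k j (i : 'I_n) :
  i \in interval mu k -> i \in interval mu j -> k = j.
Proof.
rewrite !inE => /andP[le_k lt_k] /andP[le_j lt_j].
by case: (ltngtP k j) => // lt_kj; have := sumn_take_leq mu lt_kj; lia.
Qed.

Lemma interval_reshape mu (i : 'I_n) :
  sumn mu = n -> i \in interval mu (reshape_index mu i).
Proof.
move=> sum_mu; have lt_i : i < sumn mu by rewrite sum_mu.
have := reshape_offsetP lt_i; have := reshape_indexK mu i.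
by rewrite /flatten_index inE sumn_takeS; lia.
Qed.

Lemma interval_neq0 mu (k : 'I_(size mu)) : intpart n mu -> 0 < #|interval mu k|.
Proof.
case/and3P => _ mu0 /eqP sum_mu; rewrite card_interval // lt0n.
by apply: contraNneq mu0 => <-; rewrite mem_nth.
Qed.

Lemma intervals_partition mu :
  intpart n mu -> partition (intervals n mu) [set: 'I_n].
Proof.
move=> mu_part; have /and3P[_ _ /eqP sum_mu] := mu_part.
rewrite intervalsE; apply/and3P; split.
- apply/eqP/setP => i; rewrite inE; apply/bigcupP.
  exists (interval mu (reshape_index mu i)); last exact: interval_reshape.
  have lt_i : reshape_index mu i < size mu by rewrite reshape_indexP // sum_mu.
  by apply/imsetP; exists (Ordinal lt_i).
- apply/trivIsetP => _ _ /imsetP[k _ ->] /imsetP[j _ ->] ne_kj.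
  rewrite disjoints_subset; apply/fintype.subsetP => i ik; rewrite inE.
  by apply: contraNN ne_kj => /(interval_inj ik)/ord_inj ->.
- apply/imsetP => -[k _ E]; have := interval_neq0 k mu_part.
  by rewrite -E cards0.
Qed.

Definition interval_setpart mu (mu_part : intpart n mu) : setpart n :=
  SetPart (intervals_partition mu_part).

Lemma block_type_intervals mu (mu_part : intpart n mu) :
  block_type (interval_setpart mu_part) = mu.
Proof.
have /and3P[sort_mu _ /eqP sum_mu] := mu_part.
apply: block_type_perm; rewrite // perm_sym /= intervalsE.
rewrite (perm_trans (perm_map _ (enum_imset_perm _))) //=.
  move=> k j _ _ E; have := interval_neq0 k mu_part; rewrite card_gt0.
  case/set0Pn => i ik; apply/ord_inj/(interval_inj ik).
  by rewrite -[interval mu j]E.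
rewrite -map_comp /=.
rewrite (eq_map (g := fun k : 'I_(size mu) => nth 0 mu k)) => [|k].
  by rewrite (map_comp (nth 0 mu) val) val_enum_ord -/(mkseq _ _) mkseq_nth.
exact: card_interval.
Qed.

(** Cutting [delta_word pi] into rows of lengths [block_type pi] gives back the sorted blocks. So
    [delta pi] maps the k-th interval into the k-th block, and equal sizes make this an equality. *)
Lemma delta_block_type pi : pact (delta pi) (intervals n (block_type pi)) = pi.
Proof.
set bs := sort (@block_le n) (enum pi).
have block_le_total : total (@block_le n).
  by move=> A B; rewrite /block_le; case: ltngtP => //= _; apply: leq_total.
have type_bs : block_type pi = [seq #|A| | A : {set 'I_n} <- bs].
  apply: block_type_perm; last by apply: perm_map; rewrite perm_sort.
  rewrite sorted_map; apply: sub_sorted (sort_sorted block_le_total _) => A B.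
  by rewrite /block_le /= => /orP[/ltnW //|/andP[/eqP -> _]].
pose ss := [seq enum A | A : {set 'I_n} <- bs].
have shape_ss : shape ss = block_type pi.
  by rewrite type_bs /shape -map_comp; apply: eq_map => A /=; rewrite cardE.
have /and3P[_ _ /eqP sum_t] := intpart_block_type pi.
have size_bs : size (block_type pi) = size bs by rewrite type_bs size_map.
have nth_type k : k < size bs -> nth 0 (block_type pi) k = #|nth set0 bs k|.
  by move=> lt_k; rewrite type_bs (nth_map set0).
have image_k (k : 'I_(size (block_type pi))) :
    [set delta pi i | i in interval (block_type pi) k] = nth set0 bs k.
  apply/eqP; rewrite eqEcard; apply/andP; split; last first.
    rewrite card_imset; last exact: perm_inj.
    by rewrite card_interval // nth_type -?size_bs.
  apply/fintype.subsetP => _ /imsetP[i ik ->].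
  have Ek := interval_inj (interval_reshape i sum_t) ik.
  rewrite permE /delta_fun /delta_word -/bs -/ss nth_flatten shape_ss Ek.
  rewrite (nth_map set0) -?size_bs // -mem_enum mem_nth //.
  have := @reshape_offsetP (block_type pi) i.
  by rewrite sum_t ltn_ord Ek nth_type -?size_bs // cardE => /(_ isT).
rewrite /pact intervalsE -imset_comp; apply/setP => A; apply/imsetP/idP.
  case=> k _ ->; rewrite /= image_k.
  by rewrite -mem_enum -(mem_sort (@block_le n)) mem_nth // -size_bs.
rewrite -mem_enum -(mem_sort (@block_le n)) => /(nthP set0)[k lt_k <-].
rewrite -size_bs in lt_k; exists (Ordinal lt_k) => //.
exact/esym/(image_k (Ordinal lt_k)).
Qed.

End SetPartitionAction.

(** * Symmetric functions in noncommuting variables *)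

From mathcomp Require Import functions.

Section NoncommutativeAction.
Variable n : nat.
Implicit Types (d g w : 'S_n) (P : {set {set 'I_n}}) (pi si : setpart n).
Implicit Types (f : ncseries n) (i j : word n).

Definition same_block P (a b : 'I_n) : bool :=
  [exists A in P, (a \in A) && (b \in A)].

Lemma same_block_pact d P a b : same_block (pact d P) (d a) (d b) = same_block P a b.
Proof.
apply/exists_inP/exists_inP => -[A PA /andP[Aa Ab]].
  case/imsetP: PA Aa Ab => B PB -> /imsetP[a' Ba /perm_inj ->] /imsetP[b' Bb /perm_inj ->].
  by exists B; rewrite ?Ba.
by exists (d @: A); rewrite ?imset_f.
Qed.

Lemma same_block_pblock P a b : partition P [set: 'I_n] ->
  same_block P a b = (b \in pblock P a).
Proof.
case/and3P=> /eqP covP trivP _; apply/exists_inP/idP.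
  by case=> A PA /andP[Aa Ab]; rewrite (def_pblock trivP PA Aa).
move=> ab; exists (pblock P a); first by rewrite pblock_mem ?covP.
by rewrite ab mem_pblock covP inE.
Qed.

Lemma setpart_same_block pi si : same_block pi =2 same_block si -> pi = si.
Proof.
move=> E; apply: val_inj; rewrite /= -(equivalence_partition_pblock (blocksP pi)).
rewrite -[RHS](equivalence_partition_pblock (blocksP si)).
apply: eq_imset => a; apply/setP => b; rewrite !inE.
by rewrite -!same_block_pblock ?blocksP ?E.
Qed.

Lemma nc_mE P i : nc_m P i =
  ([forall a, forall b, (i a == i b) == same_block P a b])%:R.
Proof. by []. Qed.

Lemma nc_act_m d P : nc_act d (nc_m P) = nc_m (pact d P).
Proof.
apply: boolp.funext => j; rewrite /nc_act !nc_mE; congr (nat_of_bool _)%:R.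
apply/'forall_forallP/'forall_forallP => H a b.
  rewrite -[a](permKV d) -[b](permKV d) same_block_pact -(eqP (H _ _)).
  by rewrite !ffunE !invgK.
by rewrite !ffunE !invgK -(same_block_pact d) H.
Qed.

Lemma nc_act_sum (I : Type) (r : seq I) (Q : pred I) d (F : I -> ncseries n) :
  nc_act d (\sum_(k <- r | Q k) F k) = \sum_(k <- r | Q k) nc_act d (F k).
Proof. by apply: (big_morph (nc_act d)). Qed.

Lemma nc_actZ d (c : {poly rat}) f : nc_act d (c *: f) = c *: nc_act d f.
Proof. by []. Qed.

Lemma nc_scaleE (c : {poly rat}) f i : (c *: f) i = c * f i.
Proof. by []. Qed.

(** Labelling each position by the rank of its block gives a word that occurs in [nc_m pi] and in no
    other [nc_m si]; evaluation there isolates one coefficient. *)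
Definition kernel_word pi : word n := [ffun a => enum_rank (pblock pi a) : nat].

Lemma nc_m_kernel_word si pi : nc_m si (kernel_word pi) = (si == pi)%:R.
Proof.
rewrite nc_mE; congr (nat_of_bool _)%:R.
have ker a b : (kernel_word pi a == kernel_word pi b) = same_block pi a b.
  have /and3P[/eqP covP trivP _] := blocksP pi.
  rewrite !ffunE val_eqE (inj_eq enum_rank_inj) eq_pblock ?covP ?inE //.
  by rewrite same_block_pblock ?blocksP.
apply/'forall_forallP/eqP => [H|-> a b]; last by rewrite ker.
by apply: setpart_same_block => a b; rewrite -(eqP (H a b)) ker.
Qed.

Lemma nc_m_free (c : setpart n -> {poly rat}) :
  \sum_pi c pi *: (nc_m pi : ncseries n) = 0 -> forall pi, c pi = 0.
Proof.
move=> E pi; have /= := congr1 (fun f : ncseries n => f (kernel_word pi)) E.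
rewrite functions.fct_sumE (bigD1 pi) //= big1 ?addr0.
  by rewrite nc_scaleE nc_m_kernel_word eqxx mulr1.
by move=> si ne; rewrite nc_scaleE nc_m_kernel_word (negPf ne) mulr0.
Qed.

Definition HL_nc_coef (la mu : seq nat) : {poly rat} :=
  (mult_fact mu)%:R^-1 *: map_poly (intr : int -> rat) (HL_coef n la mu).

Lemma nc_HLE pi : nc_HL pi =
  \sum_(mu <- intparts n | dominated mu (block_type pi))
     HL_nc_coef (block_type pi) mu *:
     \sum_(g in stab pi) nc_m (pact (delta pi * g)%g (intervals n mu)).
Proof.
apply: eq_bigr => mu _; congr (_ *: _); apply: eq_bigr => g _.
by rewrite nc_act_m pactM.
Qed.

Lemma pact_inj d : injective (pact d).
Proof.
by move=> P Q /(congr1 (pact d^-1)); rewrite !pactM mulgV !pact1.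
Qed.

Lemma nc_act_HL w pi : nc_act w (nc_HL pi) = nc_HL (setpart_act w pi).
Proof.
rewrite !nc_HLE block_type_act nc_act_sum; apply: eq_bigr => mu _.
rewrite nc_actZ nc_act_sum; congr (_ *: _); set wpi := setpart_act w pi.
(* Products act from left to right: [c] carries [wpi] to [pi], so g -> c g w maps the stabilizer of
   [pi] onto that of [wpi]. The same [c] serves every [mu]. *)
have [c cE c_pi] : exists2 c, (delta wpi * c)%g = delta pi & pact c wpi = pi.
  exists ((delta wpi)^-1 * delta pi)%g; first by rewrite mulKVg.
  rewrite -pactM -[RHS]delta_block_type; congr pact.
  apply: (@pact_inj (delta wpi)).
  by rewrite pactM mulVg pact1 -(block_type_act w) delta_block_type.
rewrite [RHS](reindex (fun g => c * g * w)%g) /=; last first.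
  exists (fun g => c^-1 * g * w^-1)%g => g _.
    by rewrite !mulgA mulVg mul1g mulgK.
  by rewrite !mulgA mulgV mul1g mulgKV.
apply: eq_big => [g|g _].
  by rewrite !inE -!pactM c_pi (inj_eq (@pact_inj w)).
by rewrite nc_act_m pactM !mulgA cE.
Qed.

(** The sum of all partial sums of the type, a numerical statistic that strictly increases along
    dominance. *)
Definition rank pi : nat := (\sum_(k < n.+1) sumn (take k (block_type pi)))%N.

Lemma dominated_rank si pi : dominated (block_type si) (block_type pi) ->
  block_type si != block_type pi -> (rank si < rank pi)%N.
Proof.
move/dominatedP => dom ne; rewrite ltn_neqAle leq_sum // andbT.
apply: contraNneq ne => E.
have Ek (k : 'I_n.+1) : sumn (take k (block_type si)) = sumn (take k (block_type pi)).
  apply/eqP; have := leqif_sum (P := xpredT)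
    (fun (k : 'I_n.+1) _ => leqif_eq (dom k)).
  by case=> _; rewrite [X in X == _]E eqxx => /esym/forallP/(_ k).
have part_s := intpart_block_type si; have part_p := intpart_block_type pi.
have nth_eq k : nth 0%N (block_type si) k = nth 0%N (block_type pi) k.
  have [le_n|lt_n] := leqP n k.
    by rewrite !nth_default // (leq_trans _ le_n) // intpart_size.
  have := Ek (Ordinal (lt_n : (k.+1 < n.+1)%N)); rewrite /= !sumn_takeS.
  by rewrite (Ek (Ordinal (ltnW lt_n : (k < n.+1)%N))) => /addnI.
apply/eqP; apply: (@eq_from_nth _ 0%N) => //.
(* Equal entries up to padding by 0 force equal lengths, since the parts are positive. *)
have size_le (s1 s2 : seq nat) : 0%N \notin s2 -> nth 0%N s1 =1 nth 0%N s2 ->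
    (size s2 <= size s1)%N.
  move=> s20 Es; rewrite leqNgt; apply: contra s20 => lt_s.
  by rewrite -(nth_default 0%N (leqnn (size s1))) Es mem_nth.
have /and3P[_ s0 _] := part_s; have /and3P[_ p0 _] := part_p.
by apply/eqP; rewrite eqn_leq !size_le // => k; rewrite nth_eq.
Qed.

(** The coefficient of [nc_m pi] in [nc_HL pi]: for mu = la each of the [#|stab pi|] summands is
    [nc_m pi], and the classical coefficient is 1. *)
Definition HL_diag pi : {poly rat} :=
  ((#|stab pi|)%:R / (mult_fact (block_type pi))%:R)%:P.

Lemma HL_diag_unit pi : exists v, HL_diag pi * v = 1 /\ v * HL_diag pi = 1.
Proof.
set q : rat := (#|stab pi|)%:R / (mult_fact (block_type pi))%:R.
have q0 : q != 0.
  rewrite mulf_neq0 ?invr_eq0 ?Num.Theory.pnatr_eq0 // -lt0n.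
    by apply/card_gt0P; exists 1%g; rewrite inE pact1.
  by apply: prodn_gt0 => a; apply: fact_gt0.
by exists (q^-1)%:P; rewrite -!polyCM mulfV // mulVf.
Qed.

Lemma HL_nc_coef_diag pi :
  HL_nc_coef (block_type pi) (block_type pi) *+ #|stab pi| = HL_diag pi.
Proof.
have size_le := intpart_size (intpart_block_type pi).
rewrite /HL_nc_coef HL_coef_diag ?block_type_sorted //.
by rewrite rmorph1 alg_polyC -polyCMn /HL_diag mulrC mulr_natr.
Qed.

Lemma nc_HL_triangular pi : exists a : setpart n -> {poly rat},
  (forall si, a si != 0 -> (rank si < rank pi)%N) /\
  nc_HL pi = HL_diag pi *: (nc_m pi : ncseries n) + \sum_si a si *: nc_m si.
Proof.
set la := block_type pi.
(* Replacing the elements of rank not below that of [pi] by 0 reduces control of the support to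
   membership in a span. *)
pose low si : ncseries n := if (rank si < rank pi)%N then nc_m si else 0.
suff [a Ea] : exists a : setpart n -> {poly rat},
    nc_HL pi = HL_diag pi *: (nc_m pi : ncseries n) + \sum_si a si *: low si.
  exists (fun si => if (rank si < rank pi)%N then a si else 0); split=> [si|].
    by case: ifP => // _; rewrite eqxx.
  rewrite Ea; congr (_ + _); apply: eq_bigr => si _; rewrite /low.
  by case: ifP => // _; rewrite scaler0 scale0r.
rewrite nc_HLE (big_rem la) ?mem_intparts ?intpart_block_type //=.
rewrite ifT; last by apply/dominatedP.
rewrite -HL_nc_coef_diag -scalerMnl scalerMnr.
rewrite (eq_bigr (fun=> (nc_m pi : ncseries n))) => [|g]; last first.
  by rewrite inE => /eqP stab_g; rewrite -pactM delta_block_type stab_g.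
rewrite sumr_const.
have [a ->] : lin_span low (\sum_(mu <- rem la (intparts n) | dominated mu la)
    HL_nc_coef la mu *:
      \sum_(g in stab pi) (nc_m (pact (delta pi * g)%g (intervals n mu)) : ncseries n)).
  (* The term mu = la has been removed from a duplicate-free list, so each remaining [mu] is
     strictly dominated by la and yields a set partition of smaller rank. *)
  rewrite big_seq_cond; apply: lin_span_sum => mu /andP[+ dom_mu].
  rewrite mem_rem_uniq ?intparts_uniq // !inE mem_intparts => /andP[ne_mu mu_part].
  apply: lin_spanZ => _; apply: lin_span_sum => g _.
  pose si := setpart_act (delta pi * g)%g (interval_setpart mu_part).
  have type_si : block_type si = mu by rewrite block_type_act block_type_intervals.
  have -> : nc_m (pact (delta pi * g)%g (intervals n mu)) = low si.
    by rewrite /low dominated_rank ?type_si.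
  exact: lin_span_mem.
by exists a.
Qed.

End NoncommutativeAction.

(* The basis and its invariance under permutations *)
From mathcomp Require Import boolp classical_sets.

Theorem theorem3p1 (n : nat) (n_gt0 : (0 < n)%N) :
  is_basis (NCSym n) (@nc_HL n) /\
  (forall w : 'S_n,
     (nc_act w @` range (@nc_HL n) = range (@nc_HL n))%classic).
Proof.
split.
  (* Choice gathers the expansions of all the [nc_HL pi] into a single triangular matrix [a]. *)
  have [a Ha] := choice (@nc_HL_triangular n).
  apply: (@triangular_basis _ _ _ _ _ (@rank n) (@HL_diag n) a).
  - exact: nc_m_free.
  - exact: HL_diag_unit.
  - by move=> pi; have [] := Ha pi.
  - by move=> pi; have [] := Ha pi.
move=> w; apply/seteqP; split=> [_ [_ [pi _ <-] <-]|_ [pi _ <-]].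
  by exists (setpart_act w pi) => //; rewrite nc_act_HL.
exists (nc_HL (setpart_act w^-1 pi)); first by exists (setpart_act w^-1 pi).
by rewrite nc_act_HL setpart_actM mulVg setpart_act1.
Qed.
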